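(* Let $d\ge 2$ and let $H_1,\dots,H_d$ be a complete system of mutually unbiased Hadamard matrices of order $d$ such that $H_1$ is a real Hadamard matrix. Then every column vector $v=(v_1,\dots,v_d)$ of any of the matrices $H_2,\dots,H_d$ satisfies $\sum_{k=1}^d v_k^2=0$.
   Context: A complex Hadamard matrix of order $d$ is a $d\times d$ complex matrix $H$ all of whose entries have modulus $1$ and which satisfies $HH^*=dI$ (equivalently, its rows, and its columns, are pairwise orthogonal). A real Hadamard matrix is a complex Hadamard matrix all of whose entries are $\pm 1$. Complex Hadamard matrices $H_1,\dots,H_m$ of order $d$ are called mutually unbiased (MUHs) if for all $1\le j\ne k\le m$ the matrix $\frac{1}{\sqrt d}H_j^*H_k$ is again a complex Hadamard matrix. A system $H_1,\dots,H_m$ of MUHs of order $d$ is called complete if $m=d$. *)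

(* Defs.v *)
From mathcomp Require Import all_boot all_order all_algebra.
From mathcomp Require Import sesquilinear spectral.
From mathcomp Require Import complex.
From mathcomp Require Import reals.

Set Implicit Arguments.
Unset Strict Implicit.
Unset Printing Implicit Defensive.

Import Order.TTheory GRing.Theory Num.Theory.
Local Open Scope ring_scope.
Local Open Scope complex_scope.
Local Open Scope sesquilinear_scope.

(* [^t*] is the conjugate transpose, and the norm [`|z|] of [z : R[i]] is the
   complex modulus, seen as an element of [R[i]]. *)
Definition complex_hadamard (R : realType) (d : nat) (H : 'M[R[i]]_d) : Prop :=
  (forall i j, `|H i j| = 1) /\ H *m H ^t* = (d%:R)%:M.

Definition real_hadamard (R : realType) (d : nat) (H : 'M[R[i]]_d) : Prop :=
  complex_hadamard H /\ forall i j, H i j = 1 \/ H i j = -1.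

Definition MUHs (R : realType) (m d : nat) (H : 'I_m -> 'M[R[i]]_d) : Prop :=
  (forall j, complex_hadamard (H j)) /\
  (forall j k, j != k ->
     complex_hadamard ((sqrtC d%:R)^-1 *: ((H j) ^t* *m H k))).

Definition complete_MUHs (R : realType) (m d : nat) (H : 'I_m -> 'M[R[i]]_d) :
  Prop := MUHs H /\ m = d.

(* Main.v *)
(** Let h_b run over the d^2 columns of the H_a.  The Gram matrix of the h_b is
    known in modulus, and it attains equality in a Welch-type bound; this forces
    the moment sum_b h_b(i) h_b(j) conj (h_b(k) h_b(l)) to vanish unless
    {i, j} = {k, l}.  Summing the moments with i = j and k = l gives
    sum_b |sum_k h_b(k)^2|^2 = d^3.  The d real columns of H_1 contribute d^2
    each, so nothing is left for the columns of the other matrices. *)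

Require Import Defs.
From mathcomp Require Import all_boot all_order all_algebra.
From mathcomp Require Import complex.
From mathcomp Require Import reals.
From mathcomp Require Import ring.

Import Order.TTheory GRing.Theory Num.Theory.
Local Open Scope ring_scope.

(** Used to trade moments, which are sums over [b], for Gram entries, which are sums over [p]: open
    the square and exchange the sums. *)
Lemma sum_normsq_sum (C : numClosedFieldType) (B P : finType) (x : B -> P -> C) :
  \sum_p `|\sum_b x b p| ^+ 2 = \sum_b \sum_b' \sum_p x b p * (x b' p)^*.
Proof.
under eq_bigr => p _ do rewrite normCK rmorph_sum /= big_distrlr /=.
rewrite exchange_big /=; apply: eq_bigr => b _.
by rewrite exchange_big.
Qed.

Lemma sum_pair_mul (C : comPzRingType) (I J : finType) (f : I -> C) (g : J -> C) :
  \sum_(p : I * J) f p.1 * g p.2 = (\sum_i f i) * (\sum_j g j).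
Proof. by rewrite big_distrlr /= pair_big. Qed.

(** Each pair has two rearrangements, which coincide exactly on the diagonal; hence the correction
    [- #|I|%:R]. *)
Lemma sum_same_pair (C : pzRingType) (I : finType) :
  \sum_(p : (I * I) * (I * I) | p.2 \in [set p.1; (p.1.2, p.1.1)]) 1
  = 2 * #|I|%:R ^+ 2 - #|I|%:R :> C.
Proof.
rewrite -(pair_big_dep predT (fun p q => q \in [set p; (p.2, p.1)])
            (fun _ _ => 1 : C)) /=.
have rowE (i j : I) : \sum_(q in [set (i, j); (j, i)]) 1 = 2 - (i == j)%:R :> C.
  rewrite sumr_const cards2 xpair_eqE eq_sym andbb.
  by case: eqP => _; rewrite ?subr0 // (natrD _ 1 1) addrK.
transitivity (\sum_(i : I) \sum_(j : I) (2 - (i == j)%:R : C)).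
  by rewrite pair_big; apply: eq_bigr => -[i j] _; apply: rowE.
have rowS (i : I) : \sum_(j : I) (2 - (i == j)%:R : C) = 2 * #|I|%:R - 1.
  rewrite sumrB sumr_const mulr_natr; congr (_ - _).
  rewrite (bigD1 i) //= eqxx big1 ?addr0 // => j.
  by rewrite eq_sym => /negPf ->.
under eq_bigr => i _ do rewrite rowS.
by rewrite sumr_const -[LHS]mulr_natr mulrBl mul1r expr2 mulrA.
Qed.

(* The hypothesis is equality in a Welch-type bound: the squared moduli of all
   fourth moments add up to the left-hand side, and the moments with
   {i, j} = {k, l} alone, each equal to #|B|, already give the right-hand side. *)
Lemma fourth_moment_eq0 (C : numClosedFieldType) (B I : finType)
    (h : B -> I -> C) (h1 : forall b i, `|h b i| = 1) :
  \sum_b \sum_b' `|\sum_i h b i * (h b' i)^*| ^+ 4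
    = #|B|%:R ^+ 2 * (2 * #|I|%:R ^+ 2 - #|I|%:R) ->
  forall i j k l, (k, l) \notin [set (i, j); (j, i)] ->
  \sum_b h b i * h b j * (h b k * h b l)^* = 0.
Proof.
pose x b (p : (I * I) * (I * I)) :=
  h b p.1.1 * h b p.1.2 * (h b p.2.1 * h b p.2.2)^*.
pose same (p : (I * I) * (I * I)) := p.2 \in [set p.1; (p.1.2, p.1.1)].
move=> welch.
have hV b i : h b i * (h b i)^* = 1 by rewrite -normCK h1 expr1n.
have total : \sum_p `|\sum_b x b p| ^+ 2
    = #|B|%:R ^+ 2 * (2 * #|I|%:R ^+ 2 - #|I|%:R).
  rewrite sum_normsq_sum -welch; apply: eq_bigr => b _; apply: eq_bigr => b' _.
  set g := \sum_i _.
  (* The summand at [p] splits as [u p.1 * (u p.2)^*], and [u] sums to [g ^+ 2], so the sum over [p]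
     is the fourth power of the modulus of [g]. *)
  pose u (q : I * I) := (h b q.1 * (h b' q.1)^*) * (h b q.2 * (h b' q.2)^*).
  transitivity (\sum_(p : (I * I) * (I * I)) u p.1 * (u p.2)^*).
    by apply: eq_bigr => p _; rewrite /x /u !rmorphM /= !conjCK; ring.
  rewrite (sum_pair_mul _ _ _ u (fun q => (u q)^*)) -rmorph_sum /=.
  rewrite /u (sum_pair_mul _ _ _ (fun i => h b i * (h b' i)^*)
            (fun i => h b i * (h b' i)^*)) -/g.
  by rewrite -normCK normrM -expr2 -exprM.
have diag : \sum_(p | same p) `|\sum_b x b p| ^+ 2
    = #|B|%:R ^+ 2 * (2 * #|I|%:R ^+ 2 - #|I|%:R).
  rewrite -sum_same_pair mulr_sumr; apply: eq_bigr => -[[i j] [k l]] sm.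
  suff -> : \sum_b x b (i, j, (k, l)) = #|B|%:R by rewrite normr_nat mulr1.
  rewrite -sumr_const; apply: eq_bigr => b _; rewrite /x /=.
  (* In either order the factors pair up with their conjugates, so every summand is 1 by [hV]. *)
  by move: sm; rewrite /same !inE /= => /orP[] /eqP[-> ->];
    rewrite rmorphM /= -[RHS](mulr1 1) -{1}(hV b i) -(hV b j); ring.
have off : \sum_(p | ~~ same p) `|\sum_b x b p| ^+ 2 = 0.
  apply: (addrI (\sum_(p | same p) `|\sum_b x b p| ^+ 2)).
  by rewrite addr0 [RHS]diag -[RHS]total [RHS](bigID same).
move=> i j k l nsm; apply/eqP; rewrite -normr_eq0 -sqrf_eq0; apply/eqP.
have off0 := psumr_eq0P
  (fun p _ => exprn_ge0 2 (normr_ge0 (\sum_b x b p))) off.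
exact: (off0 (i, j, (k, l)) nsm).
Qed.

Local Open Scope complex_scope.
Local Open Scope sesquilinear_scope.

(** The definition concerns rows; columns follow because a right inverse of a square matrix is also
    a left inverse. *)
Lemma hadamard_col_dot (R : realType) (d : nat) (H : 'M[R[i]]_d) :
  complex_hadamard H -> forall c c',
  \sum_k H k c * Num.conj (H k c') = d%:R *+ (c == c').
Proof.
case: d H => [|d] H [_ HH] c c'; first by case: c.
have d0 : d.+1%:R != 0 :> R[i] by rewrite pnatr_eq0.
have HK : H ^t* *m H = (d.+1%:R)%:M.
  have /mulmx1C : H *m (d.+1%:R^-1 *: H ^t*) = 1%:M.
    by rewrite -scalemxAr HH scale_scalar_mx mulVf.
  rewrite -scalemxAl => /(congr1 ( *:%R d.+1%:R)).
  by rewrite scalerA mulfV // scale1r scale_scalar_mx mulr1.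
have := congr1 (fun M : 'M[R[i]]_d.+1 => M c' c) HK.
rewrite !mxE eq_sym => <-; apply: eq_bigr => k _.
by rewrite !mxE mulrC.
Qed.

(** Up to conjugation the sum is an entry of [H ^t* *m K], whose modulus is the square root of
    [d]. *)
Lemma unbiased_col_dot (R : realType) (d : nat) (H K : 'M[R[i]]_d) :
  complex_hadamard ((sqrtC d%:R)^-1 *: (H ^t* *m K)) -> forall c c',
  `|\sum_k H k c * Num.conj (K k c')| ^+ 4 = d%:R ^+ 2.
Proof.
case: d H K => [|d] H K [u _] c c'; first by case: c.
have := u c c'; rewrite !mxE normrM normfV.
set s := `|sqrtC _|; set t := `|_| => st.
have s0 : s != 0 by rewrite normr_eq0 sqrtC_eq0 pnatr_eq0.
have -> : `|\sum_k H k c * Num.conj (K k c')| = t.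
  rewrite /t -norm_conjC rmorph_sum /=; congr `|_|; apply: eq_bigr => k _.
  by rewrite !mxE rmorphM /= conjCK.
have -> : t = s by rewrite -(mulVKf s0 t) st mulr1.
by rewrite (exprM s 2 2) -normrX sqrtCK normr_nat.
Qed.

Theorem theorem3p1 (R : realType) (d : nat) (hd : (2 <= d)%N)
    (H : 'I_d -> 'M[R[i]]_d) (i1 : 'I_d) (hi1 : i1 = 0%N :> nat) :
  complete_MUHs H -> real_hadamard (H i1) ->
  forall j : 'I_d, j != i1 ->
  forall c : 'I_d, let v := col c (H j) in \sum_(k < d) v k 0 ^+ 2 = 0.
Proof.
move=> [[had unb] _] [_ real1] j ji c v.
pose h (b : 'I_d * 'I_d) (k : 'I_d) : R[i] := H b.1 k b.2.
have h1 b k : `|h b k| = 1 by rewrite (proj1 (had b.1)).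
(* The column itself gives d^4, the others of the same matrix 0, and each of the (d-1)d columns of
   the other matrices d^2. *)
have gramE a e : \sum_b' `|\sum_k h (a, e) k * Num.conj (h b' k)| ^+ 4
    = 2 * d%:R ^+ 4 - d%:R ^+ 3.
  rewrite -(pair_bigA _ (fun a' e' =>
    `|\sum_k h (a, e) k * Num.conj (h (a', e') k)| ^+ 4)) /=.
  rewrite (bigD1 a) //= (bigD1 e) //= hadamard_col_dot // eqxx normr_nat.
  rewrite big1 ?addr0 => [|e' /negPf ne]; last first.
    by rewrite hadamard_col_dot // eq_sym ne normr0 expr0n.
  have other a' : a' != a ->
      \sum_e' `|\sum_k h (a, e) k * Num.conj (h (a', e') k)| ^+ 4
        = d%:R ^+ 2 *+ d.
    rewrite eq_sym => /unb ua'.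
    transitivity (\sum_(e' < d) (d%:R ^+ 2 : R[i])).
      by apply: eq_bigr => e' _; apply: unbiased_col_dot.
    by rewrite sumr_const card_ord.
  rewrite (eq_bigr _ other).
  rewrite sumr_const cardC1 card_ord -mulrnA -(mulr_natr (_ ^+ 2)) natrM.
  have -> : d.-1%:R = d%:R - 1 :> R[i] by rewrite -subn1 natrB // ltnW.
  ring.
have moment0 k l : k != l ->
    \sum_b h b k * h b k * Num.conj (h b l * h b l) = 0.
  move=> kl; apply: fourth_moment_eq0 => //; last first.
    by rewrite !inE !xpair_eqE eq_sym (negPf kl).
  (* With d^2 columns, both sides of the Welch equality are 2d^6 - d^5. *)
  transitivity (\sum_(b : 'I_d * 'I_d) (2 * d%:R ^+ 4 - d%:R ^+ 3 : R[i])).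
    by apply: eq_bigr => -[a e] _; apply: gramE.
  rewrite sumr_const card_prod card_ord -[LHS]mulr_natr natrM; ring.
pose q b := \sum_k h b k ^+ 2.
have qsum : \sum_b `|q b| ^+ 2 = d%:R ^+ 3.
  transitivity (\sum_k \sum_l \sum_b h b k * h b k * Num.conj (h b l * h b l)).
    rewrite exchange_big /=.
    under [RHS]eq_bigr => k _ do rewrite exchange_big /=.
    rewrite [RHS]exchange_big /=; apply: eq_bigr => b _.
    rewrite normCK rmorph_sum /= big_distrlr /= exchange_big /=.
    by apply: eq_bigr => l _; apply: eq_bigr => k _; rewrite !expr2.
  (* Only the terms with [k] equal to [l] survive; each counts the d^2 columns. *)
  transitivity (\sum_(k < d) (d%:R ^+ 2 : R[i])).
    apply: eq_bigr => k _; rewrite (bigD1 k) //= [X in _ + X]big1 ?addr0.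
      under eq_bigr => b _ do rewrite -normCK normrM !h1 mulr1 expr1n.
      by rewrite sumr_const card_prod card_ord natrM expr2.
    by move=> l lk; rewrite moment0 // eq_sym.
  by rewrite sumr_const card_ord -[LHS]mulr_natr -exprSr.
have q1 e : q (i1, e) = d%:R.
  rewrite /q -[in RHS](card_ord d) -sumr_const; apply: eq_bigr => k _.
  by rewrite /h /=; case: (real1 k e) => ->; rewrite ?sqrrN expr1n.
(* The d columns of [H i1] already account for d * d^2, the whole of [qsum]. *)
have rest : \sum_(b | b.1 != i1) `|q b| ^+ 2 = 0.
  apply: (addrI (\sum_(b | b.1 == i1) `|q b| ^+ 2)).
  transitivity (\sum_b `|q b| ^+ 2).
    by rewrite [RHS](bigID (fun b => b.1 == i1)).
  rewrite addr0 qsum; symmetry.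
  transitivity (\sum_(a | a == i1) \sum_e `|q (a, e)| ^+ 2).
    rewrite pair_big /=.
    by apply: eq_big => [[a e]|[a e] _]; rewrite /= ?andbT.
  rewrite big_pred1_eq.
  transitivity (\sum_(e < d) (d%:R ^+ 2 : R[i])).
    by apply: eq_bigr => e _; rewrite q1 normr_nat.
  by rewrite sumr_const card_ord -[LHS]mulr_natr -exprSr.
have rest0 := psumr_eq0P (fun b _ => exprn_ge0 2 (normr_ge0 (q b))) rest.
have /eqP := rest0 (j, c) ji.
rewrite sqrf_eq0 normr_eq0 => /eqP qjc.
by rewrite -[RHS]qjc; apply: eq_bigr => k _; rewrite /v mxE.
Qed.
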